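(* There is an absolute constant $\gamma>0$ such that for every integer $k>500$ and every $\delta$ with $\ln^3 k/\sqrt{k}<\delta<1/100$, there exist a dimension $d$ and a finite data set (multiset) $X\subset\mathbb{R}^d$ such that for every threshold decision tree $\mathcal{T}$ with at most $(1+\delta)k$ leaves, $$\mathrm{cost}(X,\mathcal{T})\ge \gamma\,\frac{\log^2 k}{\delta}\,\mathrm{OPT}_k(X).$$
   Context: A threshold decision tree is a rooted binary tree whose nodes correspond to cells of $\mathbb{R}^d$: the root is $\mathbb{R}^d$, and each internal node $u$ is split by a cut $(i,\xi)$ into $\{y\in u: y_i\le\xi\}$ and $\{y\in u: y_i>\xi\}$. Its leaves partition $X$ into clusters; $\mathrm{cost}(X,\mathcal{T})$ is the sum over leaves of $\sum_{x}\|x-\mu\|_2^2$, where the inner sum is over points of $X$ in the leaf and $\mu$ is the centroid of those points. $\mathrm{OPT}_k(X)$ is the minimum over all choices of $k$ centers $c^1,\dots,c^k\in\mathbb{R}^d$ of $\sum_{x\in X}\min_j\|x-c^j\|_2^2$ (the optimal unconstrained $k$-means cost). *)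

(* Defs.v *)
From HB Require Import structures.
From mathcomp Require Import all_boot all_order all_algebra.
From mathcomp Require Import all_classical all_reals all_analysis.
Set Implicit Arguments. Unset Strict Implicit. Unset Printing Implicit Defensive.
Import Order.TTheory GRing.Theory Num.Theory.
Local Open Scope ring_scope.
Local Open Scope classical_set_scope.

Section Defs.
Variable R : realType.

Definition sqdist (d : nat) (x y : 'rV[R]_d) : R :=
  \sum_(i < d) (x ord0 i - y ord0 i) ^+ 2.

Definition centroid (d : nat) (S : seq 'rV[R]_d) : 'rV[R]_d :=
  (size S)%:R^-1 *: \sum_(x <- S) x.

Definition cluster_cost (d : nat) (S : seq 'rV[R]_d) : R :=
  \sum_(x <- S) sqdist x (centroid S).

Inductive ttree (d : nat) : Type :=
| TLeaf : ttree d
| TNode : 'I_d -> R -> ttree d -> ttree d -> ttree d.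

Fixpoint nleaves (d : nat) (T : ttree d) : nat :=
  match T with
  | TLeaf => 1
  | TNode _ _ l r => nleaves l + nleaves r
  end.

Fixpoint tree_cost (d : nat) (T : ttree d) (X : seq 'rV[R]_d) : R :=
  match T with
  | TLeaf => cluster_cost X
  | TNode i xi l r =>
      tree_cost l [seq y <- X | (y : 'rV[R]_d) ord0 i <= xi] +
      tree_cost r [seq y <- X | xi < (y : 'rV[R]_d) ord0 i]
  end.

Definition kmeans_cost (d k : nat) (X : seq 'rV[R]_d) (c : 'I_k -> 'rV[R]_d) : R :=
  \sum_(x <- X) inf (range (fun j => sqdist x (c j))).

Definition OPT (d k : nat) (X : seq 'rV[R]_d) : R :=
  inf (range (fun c : 'I_k -> 'rV[R]_d => kmeans_cost X c)).

End Defs.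

(* Main.v *)
Require Import Defs.
From HB Require Import structures.
From mathcomp Require Import all_boot all_order all_algebra.
From mathcomp Require Import all_classical all_reals all_analysis.
From mathcomp Require Import ring lra zify.
Import Order.TTheory GRing.Theory Num.Theory.
Local Open Scope ring_scope.

(* The instance has k clusters {c, c + 1} (1 the all-ones vector) with c in the
   grid {0, ..., N-1}^d, where N ~ ln k / (48 delta) and d ~ 5 ln k.  The centers
   are chosen so that
   - distinct clusters are at squared distance at least D = d N^2 / 4096;
   - if a box contains m >= sqrt k centers, every slice {v_i = j} of it contains
     at least m / (4 N) of them.
   A random choice has both properties; here it is derandomized by conditional
   expectations.  A threshold xi with j <= xi < j + 1 on coordinate i separates
   exactly the clusters with c_i = j, and the clusters still intact in a cell are
   those with c in some box.  So a cut of a cell with m >= sqrt k intact clusters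
   breaks m / (4 N) of them or none, and since a binary tree isolating the
   clusters has average depth of order ln k, about k ln k / N >= 4 delta k clusters
   are broken or share their leaf.  The delta k additional leaves can absorb only
   part of these, and every remaining one pays D / 4, whereas the centers c + 1/2
   cost only k d / 2. *)

(** * Derandomized selection of the centers *)

Lemma exists_le_average (R : realFieldType) (V : finType) (A : {pred V})
    (F : V -> R) :
  (0 < #|A|)%N ->
  exists2 v, v \in A & F v * #|A|%:R <= \sum_(u in A) F u.
Proof.
move=> /card_gt0P[v0 Av0].
case: (@arg_minP _ _ _ v0 [in A] F Av0) => v Av minv; exists v => //.
by rewrite mulr_natr -sumr_const; apply: ler_sum => u Au; exact: minv.
Qed.

(* Method of conditional expectations with potential [Phi]: a uniform choice of
   the next element does not increase [Phi] on average, and excluding the elements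
   that are not far from the previous ones costs a factor [1 - 1 / (2k)]. *)
Lemma greedy_selection (R : realFieldType) (V I : finType) (P : pred I)
    (w : I -> V -> R) (far : rel V) (k : nat) :
  (forall t v, 0 <= w t v) ->
  (forall t, P t -> \sum_v w t v <= #|V|%:R) ->
  (0 < #|V|)%N -> (0 < k)%N ->
  (forall u, 2 * k ^ 2 * #|[pred v | ~~ far v u]| <= #|V|)%N ->
  exists s : seq V, [/\ size s = k, pairwise far s &
    forall t, P t -> \prod_(v <- s) w t v <= 2 * #|I|%:R].
Proof.
move=> w_ge0 w_avg V_gt0 k_gt0 few.
pose e : R := (2 * k)%:R^-1.
have k2_gt0 : 0 < (2 * k)%:R :> R by rewrite ltr0n; lia.
have e_gt0 : 0 < e by rewrite invr_gt0.
have ke : k%:R * e = 2^-1.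
  rewrite /e natrM invfM mulrCA divff ?mulr1 // pnatr_eq0; lia.
pose Phi (s : seq V) : R := \sum_(t | P t) \prod_(v <- s) w t v.
have Phi_ge0 s : 0 <= Phi s.
  by apply: sumr_ge0 => t _; apply: prodr_ge0 => v _; exact: w_ge0.
have Phi_avg s : \sum_v Phi (v :: s) <= #|V|%:R * Phi s.
  rewrite /Phi exchange_big /= mulr_sumr; apply: ler_sum => t Pt.
  under eq_bigr do rewrite big_cons.
  rewrite -mulr_suml; apply: ler_wpM2r (w_avg _ Pt).
  by apply: prodr_ge0 => v _; exact: w_ge0.
(* [1 - n * e] is Bernoulli's lower bound for [(1 - e) ^ n]; at [n = k] it equals 1/2, whence the
   factor 2 in the conclusion. *)
suff /(_ k (leqnn k))[s [sz_s far_s Phi_s]] : forall n, (n <= k)%N ->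
    exists s : seq V, [/\ size s = n, pairwise far s &
      Phi s * (1 - n%:R * e) <= #|I|%:R].
  exists s; split => // t Pt.
  have : \prod_(v <- s) w t v <= Phi s.
    rewrite /Phi (bigD1 t) //= lerDl; apply: sumr_ge0 => ? _.
    by apply: prodr_ge0 => v _; exact: w_ge0.
  move: Phi_s; rewrite ke; lra.
elim=> [_|n IHn lt_nk].
  exists [::]; split=> //; rewrite /Phi mul0r subr0 mulr1.
  under eq_bigr do rewrite big_nil.
  by rewrite sumr_const ler_nat max_card.
have [s [sz_s far_s Phi_s]] := IHn (ltnW lt_nk).
pose G := [pred v | all (far v) s].
have cardG : (1 - e) * #|V|%:R <= #|G|%:R.
  have bad : (2 * k ^ 2 * #|[predC G]| <= size s * #|V|)%N.
    rewrite {Phi_s far_s sz_s} /G; elim: s => [|u s IHs] /=.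
      by rewrite (@eq_card0 _ [predC _]) ?muln0.
    rewrite mulSn; apply: leq_trans (leq_add (few u) IHs).
    rewrite -mulnDr leq_mul2l; apply/orP; right.
    rewrite -cardUI; apply: leq_trans (leq_addr _ _).
    apply: subset_leq_card; apply/fintype.subsetP => v; rewrite !inE negb_and.
    by [].
  have := cardC G; rewrite sz_s in bad => cG.
  have bad' : (2 * k * #|[predC G]| <= #|V|)%N.
    rewrite -(leq_pmul2l k_gt0); apply: leq_trans (leq_trans bad _).
      by rewrite expnS expn1; lia.
    by rewrite leq_mul2r ltnW ?orbT.
  have {}bad' : #|[predC G]|%:R <= e * #|V|%:R.
    by rewrite mulrC ler_pdivlMr // -natrM ler_nat mulnC.
  move: cG => /(congr1 (fun n => n%:R : R)); rewrite natrD; lra.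
have ke2 : e <= 2^-1.
  by rewrite -ke ler_peMl ?ler1n ?ltW.
have V0 : 0 < #|V|%:R :> R by rewrite ltr0n.
have G_gt0 : (0 < #|G|)%N.
  rewrite -(ltr0n R); apply: lt_le_trans cardG.
  by apply: mulr_gt0 => //; lra.
(* Only the admissible [G] is averaged over; it holds a share of at least [1 - e] of [V], so the
   best [v] multiplies [Phi] by at most [1 / (1 - e)]. *)
have [v Gv le_v] := exists_le_average _ _ _ (fun v => Phi (v :: s)) G_gt0.
exists (v :: s); split; rewrite /= ?sz_s //.
  by rewrite far_s andbT.
apply: le_trans Phi_s.
have nke : n%:R * e <= 2^-1.
  by rewrite -ke ler_wpM2r ?ltW // ltr_nat.
have step : Phi (v :: s) * (1 - e) <= Phi s.
  rewrite -(ler_pM2r V0) -mulrA [leRHS]mulrC.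
  apply: le_trans (Phi_avg s).
  apply: le_trans (_ : _ <= Phi (v :: s) * #|G|%:R) _.
    exact: ler_wpM2l.
  apply: le_trans le_v _.
  rewrite [leRHS](bigID [in G]) /= lerDl; exact: sumr_ge0.
apply: le_trans (ler_wpM2r _ step); last by lra.
rewrite -mulrA ler_wpM2l //.
rewrite -natr1; have : 0 <= n%:R * e * e by rewrite !mulr_ge0 // ltW.
by lra.
Qed.

Definition in_box (d N : nat) (lo hi : 'I_d -> nat) (v : {ffun 'I_d -> 'I_N}) :
    bool :=
  [forall i, lo i <= v i < hi i]%N.

(** Only finitely many boxes matter, so the potential of [greedy_selection] can be a sum over a
    finite type. *)
Lemma in_box_clamp (d N : nat) (lo hi : 'I_d -> nat) (v : {ffun 'I_d -> 'I_N}) :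
  in_box d N (fun i => minn (lo i) N) (fun i => minn (hi i) N) v =
  in_box d N lo hi v.
Proof.
apply: eq_forallb => i; have := ltn_ord (v i); rewrite /=; lia.
Qed.

Lemma card_box_slice (d N : nat) (lo hi : 'I_d -> nat) (i : 'I_d) (j : 'I_N) :
  (lo i <= j < hi i)%N ->
  (#|[pred v | in_box d N lo hi v]| <=
   N * #|[pred v | in_box d N lo hi v & v i == j]|)%N.
Proof.
move=> Hj.
(* Resetting coordinate [i] to [j] keeps [v] in the box; recording the old value, one of [N], makes
   the map injective. *)
pose f (v : {ffun 'I_d -> 'I_N}) :=
  (v i, [ffun i' => if i' == i then j else v i']).
have f_inj : injective f.
  move=> u v [uvi /ffunP uv]; apply/ffunP => i'.
  have := uv i'; rewrite !ffunE; case: eqP => [->|] //.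
rewrite -(fintype.card_image f_inj).
set S := [pred v | _ & _].
have -> : (N * #|S| = #|[predX 'I_N & S]|)%N by rewrite cardX card_ord.
apply: subset_leq_card; apply/fintype.subsetP => _ /fintype.imageP[v + ->].
rewrite !inE /= => /forallP box_v; apply/andP; split; last by rewrite ffunE eqxx.
apply/forallP => i'; rewrite ffunE.
by case: eqP => [->|_].
Qed.

Section Weight.
Variables (R : realType) (d N : nat).

(* For a list of centers with T elements in the box and S in the slice, the
   product of the weights is exp (T / (2N) - S); having average at most 1, it can be
   kept below twice the number of choices of [t], which forces S >= T / (4N). *)
Definition slice_weight (t : {ffun 'I_d -> 'I_N.+1} * {ffun 'I_d -> 'I_N.+1} *
    ('I_d * 'I_N)) (v : {ffun 'I_d -> 'I_N}) : R :=
  let: ((lo, hi), (i, j)) := t in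
  expR ((in_box d N (fun i => lo i) (fun i => hi i) v)%:R / (2 * N%:R) -
        (in_box d N (fun i => lo i) (fun i => hi i) v && (v i == j))%:R).

(** Let [a = 1 / (2N)], with [b] points in the box and [s] in the slice. The box gains [(exp a - 1)
    b <= a b exp a <= s exp a / 2], by [card_box_slice]; the slice gives back at least as much,
    since [exp (-1) <= 1/2]. *)
Lemma slice_weight_average (lo hi : {ffun 'I_d -> 'I_N.+1}) (i : 'I_d) (j : 'I_N) :
  (lo i <= j < hi i)%N ->
  \sum_v slice_weight (lo, hi, (i, j)) v <= #|{ffun 'I_d -> 'I_N}|%:R.
Proof.
move=> Hj.
set B := in_box d N (fun i => lo i) (fun i => hi i).
have N_gt0 : 0 < N%:R :> R by rewrite ltr0n; apply: leq_ltn_trans (ltn_ord j).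
pose a : R := (2 * N%:R)^-1.
have a_gt0 : 0 < a by rewrite invr_gt0; lra.
have weightE v : slice_weight (lo, hi, (i, j)) v =
    1 + ((expR a - 1) * (B v)%:R - (expR a - expR (a - 1)) * (B v && (v i == j))%:R).
  rewrite /slice_weight -/B -/a; case: (B v) => /=; last first.
    by rewrite mul0r subrr expR0 !mulr0 subrr addr0.
  rewrite mul1r; case: eqP => _ /=; rewrite ?subr0; ring.
under eq_bigr do rewrite weightE.
rewrite big_split /= sumr_const -[leRHS]addr0 lerD2l.
rewrite sumrB -!mulr_sumr -!natr_sum.
have sumb (P : pred {ffun 'I_d -> 'I_N}) : (\sum_v (P v : nat))%N = #|P|.
  by rewrite -[in RHS]sum1_card [in RHS]big_mkcond.
rewrite !sumb.
set b := #|_|; set s := #|_|.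
have := card_box_slice d N (fun i => lo i) (fun i => hi i) i j Hj.
rewrite -/B -/b -/s -(ler_nat R) natrM => bNs.
have e_inv : expR (a - 1) <= expR a / 2.
  rewrite expRD ler_wpM2l ?expR_ge0 // expRN lef_pV2 ?posrE ?expR_gt0 //.
  have := expR_ge1Dx (1 : R); lra.
have ea : expR a * (1 - a) <= 1.
  rewrite -[leRHS](divff (lt0r_neq0 (expR_gt0 a))) ler_wpM2l ?expR_ge0 // -expRN.
  by have := expR_ge1Dx (- a).
have s_ge : a * b%:R <= s%:R / 2.
  apply: le_trans (ler_wpM2l (ltW a_gt0) bNs) _.
  by rewrite mulrA /a invfM mulfVK ?gt_eqF // mulrC.
have b0 : 0 <= b%:R :> R by [].
have s0 : 0 <= s%:R :> R by [].
have ea0 := expR_gt0 a.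
have H1 : expR a / 2 * s%:R <= (expR a - expR (a - 1)) * s%:R.
  by apply: ler_wpM2r => //; lra.
have H2 : expR a * (a * b%:R) <= expR a * (s%:R / 2) by rewrite ler_pM2l.
have H3 : expR a * (1 - a) * b%:R <= b%:R by rewrite ler_piMl.
nra.
Qed.

End Weight.

(** Subtraction is truncated, so the two inequalities together say [|u i - v i| < N / 16]. *)
Definition close_at (d N : nat) (u v : {ffun 'I_d -> 'I_N}) (i : 'I_d) : bool :=
  ((16 * (u i - v i) < N) && (16 * (v i - u i) < N))%N.

Definition far (d N : nat) (u v : {ffun 'I_d -> 'I_N}) : bool :=
  (4 * #|[pred i | close_at d N u v i]| <= 3 * d)%N.

Lemma card_close_coord (N : nat) (b : 'I_N) :
  (#|[pred a : 'I_N | (16 * (a - b) < N) && (16 * (b - a) < N)]| <=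
   (2 * (N %/ 16)).+1)%N.
Proof.
set A := [pred a | _]; pose t := (N %/ 16)%N.
have bnd (a : 'I_N) : a \in A -> (a - b <= t)%N /\ (b - a <= t)%N.
  by rewrite inE => /andP[]; rewrite /t; lia.
pose f (a : 'I_N) : 'I_(2 * t).+1 := inord (a + t - b).
have f_inj : {in A &, injective f}.
  move=> x y /bnd[x1 x2] /bnd[y1 y2] /(congr1 val).
  rewrite /f /= !inordK; [|lia..] => xy; apply: val_inj; rewrite /=; lia.
rewrite -(card_in_image f_inj) -[leqRHS]card_ord; exact: max_card.
Qed.

(* Markov's inequality for [16 ^ #close]: a coordinate is close for at most a
   fraction 1/8 + 1/N of the values, so the mean of that weight is at most [4 ^ d],
   while it is at least [8 ^ d] on the points that are not far. *)
Lemma card_not_far (d N k : nat) (u : {ffun 'I_d -> 'I_N}) :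
  (14 <= N)%N -> (2 * k ^ 2 <= 2 ^ d)%N ->
  (2 * k ^ 2 * #|[pred v | ~~ far d N v u]| <= #|{ffun 'I_d -> 'I_N}|)%N.
Proof.
move=> N_ge kd; apply: leq_trans (leq_mul kd (leqnn _)) _.
rewrite -(@leq_pmul2l (4 ^ d)) ?expn_gt0 // mulnA -expnMn.
rewrite card_ffun !card_ord -expnMn.
pose F (i : 'I_d) (a : 'I_N) :=
  if ((16 * (a - u i) < N) && (16 * (u i - a) < N))%N then 16%N else 1%N.
apply: (@leq_trans (\sum_(v : {ffun 'I_d -> 'I_N}) \prod_i F i (v i))%N).
  rewrite -sum1_card mulnC big_distrl /= [leqRHS](bigID (fun v => ~~ far d N v u)) /=.
  apply: leq_trans (leq_addr _ _); apply: leq_sum => v.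
  rewrite mul1n inE -ltnNge => nfar.
  have -> : (\prod_i F i (v i) = 16 ^ #|[pred i | close_at d N v u i]|)%N.
    by rewrite /F -big_mkcond /= prod_nat_const.
  rewrite (_ : 16 = 2 ^ 4)%N // (_ : 4 * 2 = 2 ^ 3)%N // -!expnM leq_exp2l //.
  exact: ltnW.
rewrite -(bigA_distr_bigA F).
rewrite -[X in (_ <= _ ^ X)%N](card_ord d) -prod_nat_const.
apply: leq_prod => i _.
have -> : (\sum_a F i a = N + 15 *
    #|[pred a : 'I_N | (16 * (a - u i) < N) && (16 * (u i - a) < N)]|)%N.
  rewrite -[in RHS]sum1_card [in RHS]big_mkcond big_distrr /= -[X in (X + _)%N](card_ord N).
  rewrite -sum1_card -big_split /=; apply: eq_bigr => a _.
  by rewrite /F inE; case: ifP.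
(* Each factor is at most [N + 15 (N / 8 + 1)], which is below [4 N] as [N >= 14]. *)
have := card_close_coord N (u i); lia.
Qed.

(** At least [d / 4] coordinates differ by [N / 16] or more; the offsets [b] and [c] remove at most
    [1 <= N / 32], so each contributes at least [(N / 32) ^ 2]. *)
Lemma far_sqdist (R : realFieldType) (d N : nat) (u v : {ffun 'I_d -> 'I_N}) (b c : bool) :
  (32 <= N)%N -> far d N u v ->
  d%:R * N%:R ^+ 2 / 4096 <=
    \sum_i ((u i)%:R + b%:R - ((v i)%:R + c%:R)) ^+ 2 :> R.
Proof.
move=> N_ge; rewrite /far => far_uv.
have cC : (#|[pred i | close_at d N u v i]| + #|[predC [pred i | close_at d N u v i]]| = d)%N.
  by rewrite cardC card_ord.
have {cC}far_uv : (d <= 4 * #|[predC [pred i | close_at d N u v i]]|)%N.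
  by move: far_uv cC; do 2!move: #|_|; lia.
move: far_uv; rewrite -(ler_nat R) natrM => far_uv.
have N0 : 0 <= N%:R ^+ 2 :> R by rewrite exprn_ge0.
apply: (@le_trans _ _ (#|[predC [pred i | close_at d N u v i]]|%:R * (N%:R ^+ 2 / 1024))).
  have := ler_wpM2r N0 far_uv; lra.
rewrite mulr_natl -sumr_const [leRHS](bigID [pred i | ~~ close_at d N u v i]) /=.
rewrite -[leLHS]addr0; apply: lerD; last by apply: sumr_ge0 => i _; exact: sqr_ge0.
rewrite [leLHS](eq_bigl [pred i | ~~ close_at d N u v i]) //.
apply: ler_sum => i; rewrite inE /close_at negb_and -!leqNgt => nclose.
have -> : N%:R ^+ 2 / 1024 = (N%:R / 32) ^+ 2 :> R by field.
have N32 : 32 <= N%:R :> R by rewrite ler_nat.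
have b0 : 0 <= b%:R :> R by rewrite ler0n.
have b1 : b%:R <= 1 :> R by rewrite lern1 leq_b1.
have c0 : 0 <= c%:R :> R by rewrite ler0n.
have c1 : c%:R <= 1 :> R by rewrite lern1 leq_b1.
case/orP: nclose => H.
  have {}H : (N + 16 * v i <= 16 * u i)%N by lia.
  move: H; rewrite -(ler_nat R) natrD !natrM => H.
  by rewrite ler_pXn2r ?nnegrE //; lra.
have {}H : (N + 16 * u i <= 16 * v i)%N by lia.
move: H; rewrite -(ler_nat R) natrD !natrM => H.
by rewrite -[leRHS]sqrrN ler_pXn2r ?nnegrE //; lra.
Qed.

(** For [T] centers in the box and [S] in the slice, the potential gives [T / (2N) - S <= M / (4N)],
    hence [S >= T / (4N)] once [T >= M]. The exponential hypothesis is a union bound over all boxes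
    and slices. *)
Lemma regular_selection (R : realType) (d N k : nat) (M : R) :
  (32 <= N)%N -> (0 < k)%N -> (2 * k ^ 2 <= 2 ^ d)%N ->
  2 * (N.+1 ^ d * N.+1 ^ d * (d * N))%:R <= expR (M / (4 * N%:R)) ->
  exists s : seq {ffun 'I_d -> 'I_N}, [/\ size s = k, pairwise (far d N) s &
    forall (lo hi : 'I_d -> nat) (i : 'I_d) (j : 'I_N), (lo i <= j < hi i)%N ->
      M <= (count (in_box d N lo hi) s)%:R ->
      (count (in_box d N lo hi) s)%:R <=
        4 * N%:R * (count (fun v => in_box d N lo hi v && (v i == j)) s)%:R :> R].
Proof.
move=> N_ge k_gt0 kd card_le.
have N_gt0 : 0 < N%:R :> R by rewrite ltr0n; lia.
pose P (t : {ffun 'I_d -> 'I_N.+1} * {ffun 'I_d -> 'I_N.+1} * ('I_d * 'I_N)) :=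
  (t.1.1 t.2.1 <= t.2.2 < t.1.2 t.2.1)%N.
have V_gt0 : (0 < #|{ffun 'I_d -> 'I_N}|)%N.
  by rewrite card_ffun !card_ord expn_gt0; lia.
have w_ge0 t v : 0 <= slice_weight R d N t v.
  by case: t => -[lo hi] [i j]; exact: expR_ge0.
have w_avg t : P t -> \sum_v slice_weight R d N t v <= #|{ffun 'I_d -> 'I_N}|%:R.
  by case: t => -[lo hi] [i j]; exact: slice_weight_average.
have few u := @card_not_far d N k u (leq_trans (isT : 14 <= 32)%N N_ge) kd.
have [s [sz_s far_s reg_s]] :=
  greedy_selection _ _ _ _ _ _ _ w_ge0 w_avg V_gt0 k_gt0 few.
exists s; split => // lo hi i j Hj.
pose lo' : {ffun 'I_d -> 'I_N.+1} := [ffun i => inord (minn (lo i) N)].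
pose hi' : {ffun 'I_d -> 'I_N.+1} := [ffun i => inord (minn (hi i) N)].
have lo'E i' : lo' i' = minn (lo i') N :> nat by rewrite ffunE inordK; lia.
have hi'E i' : hi' i' = minn (hi i') N :> nat by rewrite ffunE inordK; lia.
have boxE v : in_box d N (fun i => lo' i) (fun i => hi' i) v = in_box d N lo hi v.
  by rewrite -[RHS]in_box_clamp; apply: eq_forallb => i'; rewrite lo'E hi'E.
have Pt : P (lo', hi', (i, j)).
  by rewrite /P /= lo'E hi'E; have := ltn_ord j; lia.
have := reg_s _ Pt; rewrite !card_prod !card_ffun !card_ord.
move=> /le_trans/(_ card_le); rewrite /slice_weight -expR_sum ler_expR sumrB.
rewrite -mulr_suml -!natr_sum.
have sumb (Q : pred {ffun 'I_d -> 'I_N}) : (\sum_(v <- s) (Q v : nat))%N = count Q s.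
  by rewrite -big_mkcond sum1_count.
have sliceE := eq_count (fun v : {ffun 'I_d -> 'I_N} =>
  congr1 (fun b => b && (v i == j)) (boxE v)).
rewrite !sumb (eq_count boxE) sliceE /=.
set T := (count _ s)%:R; set S := (count _ s)%:R => le_TS le_MT.
have N4 : 0 < 4 * N%:R :> R by lra.
have := ler_wpM2l (ltW N4) le_TS.
have -> : 4 * N%:R * (T / (2 * N%:R) - S) = 2 * T - 4 * N%:R * S by field; lra.
have -> : 4 * N%:R * (M / (4 * N%:R)) = M by field; lra.
lra.
Qed.

(** * Cost of a tree in terms of broken clusters *)

Lemma sqdist_ge0 (R : realType) (d : nat) (x y : 'rV[R]_d) : 0 <= sqdist x y.
Proof. by apply: sumr_ge0 => i _; exact: sqr_ge0. Qed.

Lemma sqdist_trans (R : realType) (d : nat) (x y z : 'rV[R]_d) :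
  sqdist x y <= 2 * (sqdist x z + sqdist y z).
Proof.
rewrite /sqdist -big_split mulr_sumr; apply: ler_sum => i _ /=.
have := sqr_ge0 (x ord0 i + y ord0 i - 2 * z ord0 i); lra.
Qed.

Definition intact (V : eqType) (Y : seq (V * bool)) (v : V) : bool :=
  ((v, false) \in Y) && ((v, true) \in Y).
Arguments intact {V}.

(* Points at squared distance less than D / 4 from the centroid all belong to one
   cluster, so they are at most two, and at most one if no cluster is intact. *)
Lemma cluster_cost_separated (R : realType) (d : nat) (V : eqType)
    (e : V * bool -> 'rV[R]_d) (D : R) (Y : seq (V * bool)) :
  0 <= D -> uniq Y ->
  {in Y &, forall y z, y.1 != z.1 -> D <= sqdist (e y) (e z)} ->
  D / 4 * ((size Y)%:R - 1 - (has (fun y => intact Y y.1) Y)%:R) <=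
    cluster_cost (map e Y).
Proof.
move=> D_ge0 uniqY sepY; rewrite /cluster_cost big_map.
move: (centroid _) => mu.
have far_count (Q : pred (V * bool)) :
    {in Y, forall y, Q y -> D / 4 <= sqdist (e y) mu} ->
    D / 4 * (count Q Y)%:R <= \sum_(y <- Y) sqdist (e y) mu.
  move=> QY; rewrite (bigID Q) /= -[leLHS]addr0.
  apply: lerD; last by apply: sumr_ge0 => y _; exact: sqdist_ge0.
  rewrite -sum1_count natr_sum mulr_sumr big_seq_cond [leRHS]big_seq_cond.
  by apply: ler_sum => y /andP[/QY H Qy]; rewrite mulr1 H.
have D4 : 0 <= D / 4 by lra.
have [/allP all_far|/allPn[y0 Yy0]] :=
    boolP (all (fun y => D / 4 <= sqdist (e y) mu) Y).
  apply: le_trans (far_count predT _); last by move=> y /all_far.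
  by rewrite ler_wpM2l // count_predT lerBlDr lerBlDr -addrA lerDl addr_ge0.
rewrite -ltNge => near_y0.
apply: le_trans (far_count [pred y | y.1 != y0.1] _); last first.
  move=> y Yy /= /(sepY _ _ Yy Yy0) sep.
  have := sqdist_trans R d (e y) (e y0) mu; lra.
rewrite ler_wpM2l // lerBlDr lerBlDr.
rewrite -(count_predC [pred y | y.1 == y0.1] Y) natrD addrC -addrA lerD2l.
rewrite natr1 ler_nat.
apply: (@leq_trans (count_mem (y0.1, false) Y + count_mem (y0.1, true) Y)%N).
  rewrite -count_predUI; apply: leq_trans (leq_addr _ _).
  by apply: sub_count => -[v []] /= /eqP ->; rewrite eqxx ?orbT.
rewrite !count_uniq_mem //.
have : intact Y y0.1 -> has (fun y => intact Y y.1) Y.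
  by move=> Y0; apply/hasP; exists y0.
rewrite {1}/intact; case: (_ \in Y); case: (_ \in Y) => //= -> //.
Qed.

(** A leaf counts once, however many intact clusters it holds, because only one of them can lie near
    the centroid. *)
Fixpoint intact_leaves (R : realType) (d : nat) (V : eqType)
    (e : V * bool -> 'rV[R]_d) (T : ttree R d) (Y : seq (V * bool)) : nat :=
  match T with
  | TLeaf => has (fun y => intact Y y.1) Y
  | TNode i xi l r =>
      intact_leaves R d V e l [seq y <- Y | e y ord0 i <= xi] +
      intact_leaves R d V e r [seq y <- Y | xi < e y ord0 i]
  end.
Arguments intact_leaves {R d V}.

(** Each leaf is forgiven one point, and a second one if it holds an intact cluster. *)
Lemma tree_cost_separated (R : realType) (d : nat) (V : eqType)
    (e : V * bool -> 'rV[R]_d) (D : R) (T : ttree R d) (Y : seq (V * bool)) :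
  0 <= D -> uniq Y ->
  {in Y &, forall y z, y.1 != z.1 -> D <= sqdist (e y) (e z)} ->
  D / 4 * ((size Y)%:R - (nleaves T)%:R - (intact_leaves e T Y)%:R) <=
    tree_cost T (map e Y).
Proof.
move=> D_ge0; elim: T Y => [|i xi l IHl r IHr] Y uniqY sepY /=.
  exact: cluster_cost_separated.
rewrite !filter_map.
set Yl := [seq y <- Y | _]; set Yr := [seq y <- Y | preim e (fun y => xi < _) y].
have sz : size Y = (size Yl + size Yr)%N.
  rewrite !size_filter -(count_predC (fun y => e y ord0 i <= xi) Y).
  by congr addn; apply: eq_count => y; rewrite /= ltNge.
have sub (p : pred (V * bool)) : {in [seq y <- Y | p y] &,
    forall y z, y.1 != z.1 -> D <= sqdist (e y) (e z)}.
  by move=> y z; rewrite !mem_filter => /andP[_ Yy] /andP[_ Yz]; exact: sepY.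
apply: le_trans (lerD (IHl Yl _ _) (IHr Yr _ _)); rewrite ?filter_uniq //; try exact: sub.
by rewrite -mulrDr sz !natrD ler_wpM2l //; lra.
Qed.

(** * Entropy bound on the number of intact leaves *)

Lemma xlnx_ge (R : realType) (x y : R) : 0 <= x -> 0 < y ->
  x * ln y + x - y <= x * ln x.
Proof.
rewrite le_eqVlt => /predU1P[<-|x_gt0] y_gt0; first by rewrite !mul0r; lra.
have yx : -1 < y / x - 1 by rewrite ltrBrDr addNr divr_gt0.
(* Tangent line of x ln x at [y], from [ln (y / x) <= y / x - 1]. *)
have := le_ln1Dx yx; rewrite addrC subrK ln_div ?posrE // => H.
have := ler_wpM2l (ltW x_gt0) H; rewrite !mulrBr mulr1 mulrCA divff ?gt_eqF //.
lra.
Qed.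

(* Entropy inequality behind the depth bound: by convexity of x ln x, splitting
   [m = a + b + s] decreases [m ln (m / M)] by at most about [m], which the [s]
   broken clusters pay for. *)
Lemma split_entropy (R : realType) (a b s M n : R) :
  0 <= a -> 0 <= b -> 0 <= s -> 0 < M -> M <= a + b + s ->
  a + b + s <= 4 * n * s -> 1 <= n -> ln ((a + b + s) / M) <= n ->
  (a + b + s) * ln ((a + b + s) / M) <=
    6 * n * s + (a * ln (a / M) + b * ln (b / M)).
Proof.
set m := a + b + s => a0 b0 s0 M0 Mm ms n1 lnm.
have m0 : 0 < m by exact: lt_le_trans Mm.
have m2 : 0 < m / M / 2 by rewrite !divr_gt0.
have ln2 : ln 2 <= 1 :> R.
  by have := @le_ln1Dx R 1; rewrite (_ : 1 + 1 = 2) //; apply; lra.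
have E : ln (m / M / 2) = ln (m / M) - ln 2 by rewrite ln_div ?posrE ?divr_gt0.
(* Tangent at the even split [m / 2]. Adding the cases [a] and [b] loses at most [m <= 4 n s], and
   [s ln (m / M)] adds at most [n s]. *)
have gibbs c : 0 <= c ->
    c * (ln (m / M) - ln 2) + c - m / 2 <= c * ln (c / M).
  move=> c0; have := xlnx_ge _ _ _ (divr_ge0 c0 (ltW M0)) m2; rewrite E => H.
  have := ler_wpM2l (ltW M0) H; move: (ln (m / M)) (ln 2) (ln (c / M)) => x y z.
  have -> : M * (c / M * (x - y) + c / M - m / M / 2) = c * (x - y) + c - m / 2.
    by field; rewrite gt_eqF.
  by have -> : M * (c / M * z) = c * z by field; rewrite gt_eqF.
have Ha := gibbs a a0; have Hb := gibbs b b0.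
have sl : s * ln (m / M) <= s * n by rewrite ler_wpM2l.
have ml : (a + b) * ln 2 <= a + b by rewrite ler_piMr // addr_ge0.
have sn : s <= s * n by rewrite ler_peMr.
move: Ha Hb sl ms; move: (ln (m / M)) (ln (a / M)) (ln (b / M)) => x y z; rewrite /m; lra.
Qed.

Definition cluster_point (R : realType) (d N : nat)
    (y : {ffun 'I_d -> 'I_N} * bool) : 'rV[R]_d :=
  \row_i ((y.1 i)%:R + y.2%:R).

(** On coordinate [i] the two points of cluster [v] have the values [v i] and [v i + 1]; the larger
    one decides on the left, the smaller one on the right. *)
Lemma intact_cut (R : realType) (d N : nat) (i : 'I_d) (xi : R)
    (Y : seq ({ffun 'I_d -> 'I_N} * bool)) (v : {ffun 'I_d -> 'I_N}) :
  let e := cluster_point R d N in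
  intact [seq y <- Y | e y ord0 i <= xi] v = intact Y v && ((v i).+1%:R <= xi)
  /\ intact [seq y <- Y | xi < e y ord0 i] v = intact Y v && (xi < (v i)%:R).
Proof.
rewrite /intact !mem_filter !mxE /= !addr0 !natr1; split.
  have : (v i).+1%:R <= xi -> (v i)%:R <= xi.
    by apply: le_trans; rewrite ler_nat.
  case: ((v i).+1%:R <= xi) => [/(_ isT) ->|_] /=; rewrite ?andbT ?andbF //.
have : xi < (v i)%:R -> xi < (v i).+1%:R.
  by move=> /lt_le_trans; apply; rewrite ler_nat.
by case: (xi < (v i)%:R) => [/(_ isT) ->|_] /=; rewrite ?andbT ?andbF.
Qed.

(** Induction on the tree, the intact clusters of a cell being the members of [s] in some box. A cut
    through the box removes a slice, which [regs] makes large enough for [split_entropy]. *)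
Lemma intact_leaves_bound (R : realType) (d N : nat) (M : R)
    (s : seq {ffun 'I_d -> 'I_N}) :
  0 < N%:R :> R -> 2 <= M -> ln (size s)%:R <= N%:R :> R ->
  (forall (lo hi : 'I_d -> nat) (i : 'I_d) (j : 'I_N), (lo i <= j < hi i)%N ->
    M <= (count (in_box d N lo hi) s)%:R ->
    (count (in_box d N lo hi) s)%:R <=
      4 * N%:R * (count (fun v => in_box d N lo hi v && (v i == j)) s)%:R :> R) ->
  forall (T : ttree R d) (Y : seq ({ffun 'I_d -> 'I_N} * bool)) (lo hi : 'I_d -> nat),
  (forall v, intact Y v = (v \in s) && in_box d N lo hi v) ->
  let m := count (in_box d N lo hi) s in
  let l := intact_leaves (cluster_point R d N) T Y in
  (l <= m)%N /\ m%:R * ln (m%:R / M) <= 6 * N%:R * (m%:R - l%:R).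
Proof.
move=> N_gt0 M2 lnk regs.
have N1 : 1 <= N%:R :> R by rewrite ler1n -(ltr0n R).
have ln_small (m : nat) : (m <= size s)%N -> ln (m%:R / M) <= N%:R.
  case: m => [|m] ms; first by rewrite mul0r ln0.
  apply: le_trans lnk; rewrite ler_ln ?posrE ?divr_gt0 ?ltr0n //; try lra.
    rewrite ler_pdivrMr; last lra.
    apply: le_trans (_ : (size s)%:R <= _); first by rewrite ler_nat.
    by rewrite ler_peMr //; lra.
  exact: leq_trans ms.
have below (m l : nat) : (l <= m)%N -> m%:R < M ->
    m%:R * ln (m%:R / M) <= 6 * N%:R * (m%:R - l%:R).
  move=> lm mM; apply: (@le_trans _ _ 0).
    rewrite mulr_ge0_le0 // ln_le0 // ler_pdivrMr ?mul1r ?ltW //; lra.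
  by rewrite !mulr_ge0 ?subr_ge0 ?ler_nat.
elim=> [|i xi l IHl r IHr] Y lo hi intactE m L.
  have Lm : (L <= m)%N.
    rewrite /L /=; case: hasP => //= -[y _]; rewrite intactE => /andP[ys ybox].
    by rewrite /= -has_count; apply/hasP; exists y.1.
  split=> //; have [|Mm] := ltP m%:R M; first exact: below.
  (* At a leaf [l <= 1], and [m >= M >= 2] gives [m <= 6 (m - 1)]. *)
  have L1 : L%:R <= 1 :> R by rewrite lern1 /L leq_b1.
  apply: le_trans (ler_wpM2l _ (ln_small m (count_size _ _))) _ => //.
  rewrite mulrC -mulrA mulrCA ler_pM2l //; lra.
have intactl v := (intact_cut R d N i xi Y v).1.
have intactr v := (intact_cut R d N i xi Y v).2.
rewrite /= in intactl intactr.
pose Yl := [seq y <- Y | cluster_point R d N y ord0 i <= xi].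
pose Yr := [seq y <- Y | xi < cluster_point R d N y ord0 i].
(* A cell without intact clusters matches the empty box with all bounds 0, for which the induction
   hypothesis forces [l <= 0]. *)
have intact0 (Z : seq ({ffun 'I_d -> 'I_N} * bool)) : (forall v, intact Z v = false) ->
    forall T, (forall lo hi, (forall v, intact Z v = (v \in s) && in_box d N lo hi v) ->
  let m := count (in_box d N lo hi) s in
  let l := intact_leaves (cluster_point R d N) T Z in
  (l <= m)%N /\ m%:R * ln (m%:R / M) <= 6 * N%:R * (m%:R - l%:R)) ->
    intact_leaves (cluster_point R d N) T Z = 0%N.
  move=> Z0 T /(_ (fun=> 0%N) (fun=> 0%N)).
  have box0 v : v \in s -> in_box d N (fun=> 0%N) (fun=> 0%N) v = false.
    by move=> _; apply/negP => /forallP/(_ i); rewrite ltn0 andbF.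
  rewrite (eq_in_count box0) count_pred0 => -[]; last by case: intact_leaves.
  by move=> v; rewrite Z0; case: (boolP (v \in s)) => //= /box0 ->.
have trivial_cut : (forall v, intact Yl v = intact Y v) /\ (forall v, intact Yr v = false) \/
    (forall v, intact Yr v = intact Y v) /\ (forall v, intact Yl v = false) ->
    (L <= m)%N /\ m%:R * ln (m%:R / M) <= 6 * N%:R * (m%:R - L%:R).
  case=> -[same none].
    have := IHl Yl lo hi; have := intact0 Yr none r (IHr Yr).
    rewrite /L /= -/Yl -/Yr => -> H; rewrite addn0; apply: H => v.
    by rewrite same intactE.
  have := IHr Yr lo hi; have := intact0 Yl none l (IHl Yl).
  rewrite /L /= -/Yl -/Yr => -> H; rewrite add0n; apply: H => v.
  by rewrite same intactE.
(* [Num.trunc] is 0 on negative reals, so negative thresholds, which leave every cluster on the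
   right, are settled first. *)
have [xi0|xi0] := ltP xi 0.
  apply: trivial_cut; right; split=> v.
    by rewrite /Yr intactr (lt_le_trans xi0) ?andbT.
  by rewrite /Yl intactl leNgt (lt_le_trans xi0) ?andbF.
have boxi (v : {ffun 'I_d -> 'I_N}) :
    in_box d N lo hi v -> (lo i <= v i < minn (hi i) N)%N.
  by move=> /forallP/(_ i); rewrite leq_min ltn_ord andbT.
pose j := Num.trunc xi.
have cutl (v : {ffun 'I_d -> 'I_N}) : ((v i).+1%:R <= xi) = (v i < j)%N
  by rewrite /j truncn_ge_nat.
have cutr (v : {ffun 'I_d -> 'I_N}) : (xi < (v i)%:R) = (j < v i)%N
  by rewrite /j truncn_lt_nat.
have [jlo|jlo] := ltnP j (lo i).
  apply: trivial_cut; right; split=> v.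
    rewrite /Yr intactr cutr intactE andb_idr // => /andP[_ /boxi/andP[lov _]].
    exact: leq_trans lov.
  rewrite /Yl intactl cutl intactE; apply/negP => /andP[/andP[_ /boxi/andP[lov _]]].
  by rewrite ltnNge (leq_trans (ltnW jlo)).
(* [hi i] may exceed [N], whereas the slice index must be below [N]; hence the minimum. *)
have [jhi|jhi] := leqP (minn (hi i) N) j.
  apply: trivial_cut; left; split=> v.
    rewrite /Yl intactl cutl intactE andb_idr // => /andP[_ /boxi/andP[_ hiv]].
    exact: leq_trans jhi.
  rewrite /Yr intactr cutr intactE; apply/negP => /andP[/andP[_ /boxi/andP[_ hiv]]].
  by rewrite ltnNge ltnW // (leq_trans hiv).
have jN : (j < N)%N by apply: leq_trans jhi (geq_minr _ _).
(* Both halves omit the slice [j], whose clusters are the broken ones. *)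
pose lo' i' := if i' == i then j.+1 else lo i'.
pose hi' i' := if i' == i then j else hi i'.
have boxl v : in_box d N lo hi' v = in_box d N lo hi v && (v i < j)%N.
  apply/forallP/andP => [H|[/forallP H vj] i'].
    split; last by have := H i; rewrite /hi' eqxx => /andP[].
    apply/forallP => i'; have := H i'; rewrite /hi'; case: eqP => [->|//]; lia.
  by have := H i'; rewrite /hi'; case: eqP => [->|//]; lia.
have boxr v : in_box d N lo' hi v = in_box d N lo hi v && (j < v i)%N.
  apply/forallP/andP => [H|[/forallP H vj] i'].
    split; last by have := H i; rewrite /lo' eqxx => /andP[].
    apply/forallP => i'; have := H i'; rewrite /lo'; case: eqP => [->|//]; lia.
  by have := H i'; rewrite /lo'; case: eqP => [->|//]; lia.
have [] := IHl Yl lo hi'.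
  by move=> v; rewrite /Yl intactl cutl intactE boxl andbA.
have [] := IHr Yr lo' hi.
  by move=> v; rewrite /Yr intactr cutr intactE boxr andbA.
set mr := count _ s; set lr := intact_leaves _ _ _ => lmr Hr.
set ml := count _ s; set ll := intact_leaves _ _ _ => lml Hl.
pose S := count (fun v => in_box d N lo hi v && (v i == Ordinal jN)) s.
have mE : m = (ml + mr + S)%N.
  rewrite /m /ml /mr /S (eq_count boxl) (eq_count boxr).
  elim: (s) => //= v s' ->; rewrite -val_eqE /=.
  by case: in_box => //=; case: ltngtP => _ //=; clear; lia.
have LE : L = (ll + lr)%N by [].
have Lm : (L <= m)%N.
  by rewrite LE mE (leq_trans _ (leq_addr _ _)) // leq_add.
split=> //; have [|Mm] := ltP m%:R M; first exact: below.
have jbox : (lo i <= Ordinal jN < hi i)%N.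
  by move: jhi; rewrite jlo leq_min => /andP[].
have mS := regs lo hi i (Ordinal jN) jbox Mm.
rewrite -/m -/S in mS.
have lnm := ln_small m (count_size _ _).
move: mS Mm lnm; rewrite LE mE !natrD => mS Mm lnm.
apply: le_trans (split_entropy _ _ _ _ _ _ _ _ _ _ Mm mS N1 lnm) _ => //; first lra.
move: Hl Hr; lra.
Qed.

(** * Bounds on the optimal cost *)

Lemma inf_range_ge0 (R : realType) (T : Type) (F : T -> R) :
  (forall t, 0 <= F t) -> 0 <= inf (range F).
Proof.
move=> F0; have [->|nonempty] := eqVneq (range F) set0; first by rewrite inf0.
by apply: lb_le_inf; [exact/set0P|move=> _ [t _ <-]].
Qed.

Lemma inf_range_le (R : realType) (T : Type) (F : T -> R) (t : T) :
  (forall t, 0 <= F t) -> inf (range F) <= F t.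
Proof. by move=> F0; apply: ge_inf; [exists 0 => _ [u _ <-]|exists t]. Qed.

Lemma kmeans_cost_ge0 (R : realType) (d k : nat) (X : seq 'rV[R]_d)
    (c : 'I_k -> 'rV[R]_d) : 0 <= kmeans_cost X c.
Proof.
by apply: sumr_ge0 => x _; apply: inf_range_ge0 => j; exact: sqdist_ge0.
Qed.

Lemma OPT_le_assignment (R : realType) (d k : nat) (L : Type)
    (e : L -> 'rV[R]_d) (Y : seq L) (c : 'I_k -> 'rV[R]_d) (f : L -> 'I_k) :
  OPT k (map e Y) <= \sum_(y <- Y) sqdist (e y) (c (f y)).
Proof.
apply: le_trans (inf_range_le _ _ _ c _) _; first exact: kmeans_cost_ge0.
rewrite /kmeans_cost big_map; apply: ler_sum => y _.
by apply: (inf_range_le _ _ (fun j => sqdist (e y) (c j))) => j; exact: sqdist_ge0.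
Qed.

(* Pigeonhole: two of the points share a nearest center. *)
Lemma OPT_gt0 (R : realType) (d k : nat) (L : eqType)
    (e : L -> 'rV[R]_d) (Y : seq L) (r : R) :
  (0 < k)%N -> (k < size Y)%N -> uniq Y -> 0 < r ->
  {in Y &, forall y z, y != z -> r <= sqdist (e y) (e z)} ->
  0 < OPT k (map e Y).
Proof.
move=> k_gt0 kY uniqY r_gt0 sepY.
apply: lt_le_trans (_ : r / 4 <= _); first lra.
apply: lb_le_inf; first by exists (kmeans_cost (map e Y) (fun _ : 'I_k => 0)), (fun=> 0).
move=> _ [c _ <-]; rewrite leNgt; apply/negP => small.
pose F y j := sqdist (e y) (c j).
pose a y : 'I_k := [arg min_(j < Ordinal k_gt0) F y j]%O.
have F_small : {in Y, forall y, F y (a y) < r / 4}.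
  move=> y Yy; apply: le_lt_trans small.
  rewrite /kmeans_cost big_map (big_rem y Yy) /= -[leLHS]addr0; apply: lerD.
    apply: lb_le_inf; first by exists (F y (a y)), (a y).
    by move=> _ [j _ <-]; rewrite /a; case: arg_minP => // j' _; exact.
  by apply: sumr_ge0 => x _; apply: inf_range_ge0 => j; exact: sqdist_ge0.
have a_inj : {in Y &, injective a}.
  move=> y z Yy Yz ayz; apply/eqP; apply: contraT => /(sepY _ _ Yy Yz).
  have := sqdist_trans R d (e y) (e z) (c (a y)).
  have := F_small y Yy; have := F_small z Yz; rewrite /F -ayz; lra.
have := uniq_leq_size (s1 := map a Y) (s2 := enum 'I_k).
rewrite map_inj_in_uniq // => /(_ uniqY) H.
have : (size (map a Y) <= size (enum 'I_k))%N.
  by apply: H => j _; rewrite mem_enum.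
by rewrite size_map size_enum_ord leqNgt kY.
Qed.

(** * Numerical estimates and choice of the parameters *)

Lemma ln2_ge (R : realType) : 1 / 2 <= ln 2 :> R.
Proof.
rewrite -ler_expR lnK ?posrE // -[leLHS]invrK -expRN.
rewrite -[leRHS]invrK lef_pV2 ?posrE ?expR_gt0 ?invr_gt0 //.
have := expR_ge1Dx (- (1 / 2) : R); lra.
Qed.

Lemma expR1_le3 (R : realType) : expR 1 <= 3 :> R.
Proof.
have H : 5 / 6 <= expR (- (1 / 6)) :> R.
  by have := expR_ge1Dx (- (1 / 6) : R); lra.
(* The bound is [(6 / 5) ^ 6 < 3]. *)
have -> : 1 = 6%:R * (1 / 6) :> R by lra.
rewrite expRM_natl -[X in X ^+ 6]invrK -expRN.
have : (expR (- (1 / 6)))^-1 <= 6 / 5 :> R.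
  by rewrite -[leRHS]invrK lef_pV2 ?posrE ?expR_gt0 //; lra.
set x := _^-1 => xle; apply: (@le_trans _ _ ((6 / 5) ^+ 6)); last by lra.
by rewrite ler_pXn2r ?nnegrE ?invr_ge0 ?expR_ge0 //; lra.
Qed.

(** A nonempty range for [delta] forces [k] to be large: [ln k <= 16] would give [sqrt k <= 3 ^ 8],
    so [ln k ^ 3 < 66], against [ln k > 5]. *)
Lemma ln_large (R : realType) (k : nat) :
  (500 < k)%N -> ln k%:R ^+ 3 / Num.sqrt k%:R < 1 / 100 :> R ->
  16 < ln k%:R :> R.
Proof.
move=> k500; have k0 : 0 < k%:R :> R by rewrite ltr0n; lia.
have e3 (n : nat) : expR n%:R <= 3 ^+ n :> R.
  rewrite -[n%:R]mulr1 expRM_natl; apply: lerXn2r; rewrite ?nnegrE ?expR_ge0 //.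
  exact: expR1_le3.
have L5 : 5 < ln k%:R :> R.
  rewrite -ltr_expR lnK ?posrE //; apply: le_lt_trans (e3 5%N) _.
  by rewrite -natrX ltr_nat; apply: leq_trans k500.
have sqrt_gt0 : 0 < Num.sqrt k%:R :> R by rewrite sqrtr_gt0.
rewrite ltr_pdivrMr // => H; rewrite ltNge; apply/negP => L16.
have L3 : 5 ^+ 3 <= ln k%:R ^+ 3 :> R by apply: lerXn2r; rewrite ?nnegrE //; lra.
have : Num.sqrt k%:R <= 3 ^+ 8 :> R.
  rewrite -[leRHS]ger0_norm ?exprn_ge0 // -sqrtr_sqr ler_wsqrtr //.
  apply: (@le_trans _ _ (expR 16)); first by rewrite -{1}(lnK (x := k%:R)) ?posrE // ler_expR.
  by apply: le_trans (e3 16%N) _; rewrite -exprM.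
by move: L3 H; lra.
Qed.

Lemma parameters_exist (R : realType) (k : nat) (delta : R) :
  (500 < k)%N -> ln k%:R ^+ 3 / Num.sqrt k%:R < delta -> delta < 1 / 100 ->
  exists d N : nat,
    [/\ [/\ (0 < d)%N, (32 <= N)%N & (2 * k ^ 2 <= 2 ^ d)%N],
        2 * (N.+1 ^ d * N.+1 ^ d * (d * N))%:R <=
          expR (Num.sqrt k%:R / (4 * N%:R)) :> R,
        ln k%:R <= N%:R :> R, ln k%:R <= 96 * delta * N%:R &
        48 * delta * N%:R <= ln k%:R].
Proof.
move=> k500 delta_gt delta_lt.
have L16 := ln_large R k k500 (lt_trans delta_gt delta_lt).
have k0 : 0 < k%:R :> R by rewrite ltr0n; lia.
have sqrt_gt0 : 0 < Num.sqrt k%:R :> R by rewrite sqrtr_gt0.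
have sqrtE : Num.sqrt k%:R = expR (ln k%:R / 2) :> R.
  rewrite -[X in Num.sqrt X](lnK (x := k%:R)) ?posrE // {1}(splitr (ln _)) expRD.
  by rewrite -expr2 sqrtr_sqr ger0_norm ?expR_ge0.
have expL : expR (ln k%:R) = k%:R :> R by rewrite lnK ?posrE.
move: (ln k%:R) L16 delta_gt sqrtE expL => L L16 delta_gt sqrtE expL.
move: (Num.sqrt k%:R) sqrt_gt0 delta_gt sqrtE => q q_gt0 delta_gt qE.
have L3 : 0 < L ^+ 3 by rewrite exprn_gt0 //; lra.
have delta_gt0 : 0 < delta by apply: lt_trans delta_gt; rewrite divr_gt0.
pose x := L / (48 * delta).
have xE : 48 * delta * x = L by rewrite /x; field; lra.
have x_ge : 2 * L <= x by rewrite /x ler_pdivlMr; nra.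
(* Rounding [x] down costs at most a factor 2, whence 48 and 96. Since [ln 2 >= 1/2], [d] near [5 L]
   makes [2 ^ d] reach [2 k ^ 2]. *)
pose N := Num.trunc x; pose d := Num.trunc (5 * L).
have /andP[Nx xN] : N%:R <= x < N.+1%:R by apply: truncn_itv; lra.
have /andP[dL Ld] : d%:R <= 5 * L < d.+1%:R by apply: truncn_itv; lra.
clearbody x N d; rewrite -natr1 in xN; rewrite -natr1 in Ld.
have N32 : (32 <= N)%N by rewrite -ltnS -(ltr_nat R) -natr1; lra.
have N0 : 0 < N%:R :> R by rewrite ltr0n (leq_trans _ N32).
have d0 : (0 < d)%N by rewrite -(ltr_nat R) ; lra.
(* The lower bound on [delta] enters here, as [L ^ 3 < delta q], together with [48 delta N <= L]. *)
have NL2 : 48 * N%:R * L ^+ 2 <= q.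
  have H : 48 * delta * N%:R <= L by rewrite -xE ler_wpM2l //; lra.
  move: delta_gt; rewrite ltr_pdivrMr // => delta_gt.
  have L0 : 0 < L by lra.
  rewrite -(ler_pM2l L0).
  apply: (@le_trans _ _ (48 * N%:R * (delta * q))).
    rewrite (_ : L * _ = 48 * N%:R * L ^+ 3); last by ring.
    by rewrite ler_wpM2l ?ltW //; lra.
  have -> : 48 * N%:R * (delta * q) = 48 * delta * N%:R * q by ring.
  by rewrite ler_wpM2r // ltW.
have L_sqr : L <= L ^+ 2 by rewrite expr2 ler_peMr //; lra.
have NL : 48 * N%:R * L <= q.
  by apply: le_trans NL2; rewrite ler_wpM2l //; lra.
have N1 : 1 <= N%:R :> R by rewrite ler1n (leq_trans _ N32).
have Nq : 768 * N%:R <= q.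
  have : N%:R * 16 <= N%:R * L by rewrite ler_pM2l //; lra.
  by lra.
exists d, N; split; first split=> //.
- rewrite -(ler_nat R) natrM !natrX -expL.
  rewrite -[X in X * _](lnK (x := 2)) ?posrE // -[X in _ <= X ^+ d](lnK (x := 2)) ?posrE //.
  rewrite -!expRM_natl -expRD ler_expR.
  have := ln2_ge R; have d1 : 4 * L <= d%:R - 1 by lra.
  have : 0 <= d%:R - 1 :> R by lra.
  nra.
(* The logarithm of the left side is at most [L d + L / 2 <= 6 L ^ 2], while
   [q / (4 N) >= 12 L ^ 2]. *)
- have {}Nq : N.+1%:R <= q by rewrite -natr1; lra.
  have q1 : 0 <= q by lra.
  rewrite !natrM !natrX.
  have H1 : N.+1%:R ^+ d <= expR (L / 2 * d%:R).
    by rewrite expRM_natr -qE lerXn2r // ?nnegrE.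
  have H2 : 2 * (d%:R * N%:R) <= expR (L / 2).
    have : d%:R * N%:R <= 5 * L * N%:R by rewrite ler_pM2r.
    have : 0 <= N%:R * L by rewrite mulr_ge0 //; lra.
    by rewrite -qE; lra.
  have {H1}H1 : N.+1%:R ^+ d * N.+1%:R ^+ d <= expR (L / 2 * d%:R) * expR (L / 2 * d%:R).
    by rewrite ler_pM // exprn_ge0.
  apply: (@le_trans _ _ (expR (L / 2 * d%:R) * expR (L / 2 * d%:R) * expR (L / 2))).
    by rewrite mulrCA; apply: ler_pM.
  rewrite -!expRD ler_expR ler_pdivlMr; last lra.
  apply: le_trans NL2.
  have : L / 2 * d%:R + L / 2 * d%:R + L / 2 <= 6 * L ^+ 2.
    have : L * d%:R <= L * (5 * L) by rewrite ler_wpM2l //; lra.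
    by lra.
  have := mulr_ge0 (ltW N0) (sqr_ge0 L).
  by move=> NL0 /(ler_wpM2r (ltW N0)); lra.
- by lra.
- by have := ler_wpM2l (ltW delta_gt0) (ltW xN); have := ler_wpM2l (ltW delta_gt0) N1; lra.
by rewrite -xE ler_wpM2l //; lra.
Qed.

(** * Assembly of the lower bound *)

Lemma pairwise_sym_in (T : eqType) (r : rel T) (s : seq T) :
  symmetric r -> pairwise r s -> {in s &, forall x y, x != y -> r x y}.
Proof.
move=> r_sym; elim: s => //= a s IHs /andP[/allP ra rs] x y.
rewrite !inE => /predU1P[->|xs] /predU1P[->|ys]; first by rewrite eqxx.
- by move=> _; exact: ra.
- by move=> _; rewrite r_sym; exact: ra.
- exact: IHs.
Qed.

Lemma far_irreflexive (d N : nat) (v : {ffun 'I_d -> 'I_N}) :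
  (0 < d)%N -> (0 < N)%N -> ~~ far d N v v.
Proof.
move=> d_gt0 N_gt0; rewrite /far (@eq_card _ _ predT) ?card_ord; first by lia.
by move=> i; rewrite !inE /close_at subnn muln0 N_gt0.
Qed.

Lemma far_sym (d N : nat) : symmetric (far d N).
Proof.
move=> u v; rewrite /far; congr (4 * _ <= _)%N.
by apply: eq_card => i; rewrite !inE /close_at andbC.
Qed.

Lemma ratio_constant (R : realFieldType) :
  exists gamma : R, 0 < gamma /\ forall k d N delta L : R,
    0 <= k -> 0 <= d -> 0 < delta -> 0 <= L -> L <= 96 * delta * N ->
    gamma * (L ^+ 2 / delta) * (k * d / 2) <=
      d * N ^+ 2 / 4096 / 4 * (3 * delta * k).
Proof.
(* 16384 = 4 * 4096 and 9216 = 96 ^ 2. *)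
exists (16384 * 9216)^-1; split; first by rewrite invr_gt0; lra.
move=> k d N delta L k0 d0 delta_gt0 L0 LN.
have L2 : L ^+ 2 / delta <= 9216 * (delta * N ^+ 2).
  rewrite ler_pdivrMr //.
  have -> : 9216 * (delta * N ^+ 2) * delta = (96 * delta * N) ^+ 2 by ring.
  by rewrite lerXn2r // nnegrE; lra.
have kd0 : 0 <= k * d by rewrite mulr_ge0.
have H := ler_wpM2l kd0 L2.
have y0 : 0 <= k * d * (delta * N ^+ 2).
  by apply: mulr_ge0 => //; apply: mulr_ge0; [exact: ltW|exact: sqr_ge0].
move: H y0; have -> : d * N ^+ 2 / 4096 / 4 * (3 * delta * k) =
    k * d * (delta * N ^+ 2) * (3 / 16384) by field.
move: (L ^+ 2 / delta) (delta * N ^+ 2) => z y H y0.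
have -> : (16384 * 9216)^-1 * z * (k * d / 2) = k * d * z / (2 * 16384 * 9216).
  by field.
by lra.
Qed.

Definition labels (V : eqType) (s : seq V) : seq (V * bool) :=
  [seq (v, b) | v <- s, b <- [:: false; true]].
Arguments labels {V}.

Lemma mem_labels (V : eqType) (s : seq V) (v : V) (b : bool) :
  ((v, b) \in labels s) = (v \in s).
Proof.
apply/allpairsP/idP => [[[v' b'] [/= sv' _ [-> _]]] //|sv].
by exists (v, b); split=> //; case: b.
Qed.

Lemma labels_uniq (V : eqType) (s : seq V) : uniq s -> uniq (labels s).
Proof. by move=> us; rewrite allpairs_uniq // => -[v b] [v' b'] /= _ _ [-> ->]. Qed.

Lemma size_labels (V : eqType) (s : seq V) : size (labels s) = (2 * size s)%N.
Proof. by rewrite size_allpairs mulnC. Qed.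

Lemma OPT_cluster_points (R : realType) (d N k : nat)
    (s : seq {ffun 'I_d -> 'I_N}) :
  (0 < k)%N -> size s = k ->
  OPT k (map (cluster_point R d N) (labels s)) <= k%:R * d%:R / 2.
Proof.
move=> k_gt0 sz_s; pose v0 := nth (tnth (in_tuple s) (cast_ord (esym sz_s) (Ordinal k_gt0))) s.
(* Each of the [2 k] points is at squared distance [d / 4] from its center. The default index in [f]
   is never reached, as the labels come from [s]. *)
pose c (j : 'I_k) : 'rV[R]_d := \row_i ((v0 j i)%:R + 1 / 2).
pose f (y : {ffun 'I_d -> 'I_N} * bool) : 'I_k :=
  odflt (Ordinal k_gt0) (insub (index y.1 s)).
apply: le_trans (OPT_le_assignment R d k _ _ (labels s) c f) _.
rewrite big_seq (eq_bigr (fun=> d%:R / 4)) => [|y yY].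
  rewrite -big_seq big_const_seq count_predT iter_addr_0 size_labels sz_s.
  by rewrite -[_ *+ (2 * k)]mulr_natr natrM; lra.
have sy : y.1 \in s by case: y yY => v b; rewrite mem_labels.
rewrite /sqdist (eq_bigr (fun=> 1 / 4)) => [|i _].
  by rewrite sumr_const card_ord -[_ *+ d]mulr_natr; lra.
rewrite !mxE /f insubT -?sz_s ?index_mem // => lt_y /=.
by rewrite /v0 nth_index //; case: (y.2); rewrite /=; lra.
Qed.

(** The entropy bound gives [k - l >= 4 delta k]; the leaves beyond [k] absorb at most [delta k] of
    this, which leaves [3 delta k] charges of [D / 4]. *)
Lemma excess_bound (R : realFieldType) (k N L delta l leaves D : R) :
  0 < k -> 0 < N -> 0 <= D -> 48 * delta * N <= L ->
  k * (L / 2) <= 6 * N * (k - l) -> leaves <= (1 + delta) * k ->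
  D / 4 * (3 * delta * k) <= D / 4 * (2 * k - leaves - l).
Proof.
move=> k_gt0 N_gt0 D_ge0 NL kL le_leaves.
rewrite ler_wpM2l ?divr_ge0 //.
have gain : 4 * delta * k <= k - l.
  have N12 : 0 < 12 * N by lra.
  rewrite -(ler_pM2l N12).
  apply: (@le_trans _ _ (k * L)); last by lra.
  by have := ler_wpM2l (ltW k_gt0) NL; lra.
by lra.
Qed.

Lemma ln_div_sqrt (R : realType) (x : R) :
  0 < x -> ln (x / Num.sqrt x) = ln x / 2.
Proof.
move=> x_gt0; have sqrtK : Num.sqrt x ^+ 2 = x by rewrite sqr_sqrtr ?ltW.
have sqrt_gt0 : 0 < Num.sqrt x by rewrite sqrtr_gt0.
rewrite -{1 3}sqrtK lnXn // expr2 mulfK ?gt_eqF //.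
by rewrite mulr2n; lra.
Qed.

Lemma sqdist_cluster (R : realType) (d N : nat) (v : {ffun 'I_d -> 'I_N})
    (b c : bool) :
  b != c -> d%:R <= sqdist (cluster_point R d N (v, b)) (cluster_point R d N (v, c)).
Proof.
move=> bc; rewrite /sqdist -[d in leLHS]card_ord -sumr_const.
apply: ler_sum => i _; rewrite !mxE /=.
by case: b c bc => -[] //= _; lra.
Qed.

Theorem theorem2 (R : realType) :
  exists gamma : R, 0 < gamma /\
  forall (k : nat) (delta : R),
    (500 < k)%N ->
    (ln k%:R) ^+ 3 / Num.sqrt k%:R < delta -> delta < 1 / 100 ->
    exists (d : nat) (X : seq 'rV[R]_d),
      0 < OPT k X /\
      forall T : ttree R d,
        (nleaves T)%:R <= (1 + delta) * k%:R ->
        tree_cost T X >= gamma * ((ln k%:R) ^+ 2 / delta) * OPT k X.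
Proof.
have [gamma [gamma_gt0 ratio]] := ratio_constant R.
exists gamma; split; first by [].
move=> k delta k500 delta_gt delta_lt.
have [d [N [[d_gt0 N32 kd] card_le LN N_ge N_le]]] :=
  parameters_exist R k delta k500 delta_gt delta_lt.
have k_gt0 : (0 < k)%N by exact: leq_trans k500.
have kR_gt0 : 0 < k%:R :> R by rewrite ltr0n.
have d_gt0R : 0 < d%:R :> R by rewrite ltr0n.
have N_gt0 : 0 < N%:R :> R by rewrite ltr0n (leq_trans _ N32).
have sqrt_gt0 : 0 < Num.sqrt k%:R :> R by rewrite sqrtr_gt0.
have L_gt0 : 0 < ln k%:R :> R by rewrite ln_gt0 // ltr1n (leq_trans _ k500).
have delta_gt0 : 0 < delta.
  by apply: lt_trans delta_gt; rewrite divr_gt0 // exprn_gt0.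
have [s [sz_s far_s reg_s]] := regular_selection R d N k _ N32 k_gt0 kd card_le.
pose D : R := d%:R * N%:R ^+ 2 / 4096.
have D_gt0 : 0 < D.
  by apply: divr_gt0; [rewrite mulr_gt0 ?exprn_gt0|rewrite ltr0n].
pose e := cluster_point R d N.
pose Y := labels s.
have memY := mem_labels _ s.
have uniq_s : uniq s.
  by apply: pairwise_uniq far_s => v; apply/negbTE/far_irreflexive => //; exact: leq_trans N32.
have uniqY : uniq Y by exact: labels_uniq.
have sizeY : size Y = (2 * k)%N by rewrite size_labels sz_s.
have sep : {in Y &, forall y z, y.1 != z.1 -> D <= sqdist (e y) (e z)}.
  move=> [v b] [w c]; rewrite !memY /= => sv sw vw.
  have far_vw := pairwise_sym_in _ _ s (far_sym d N) far_s v w sv sw vw.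
  have := far_sqdist R d N v w b c N32 far_vw.
  rewrite /sqdist /e; congr (_ <= _); apply: eq_bigr => i _; by rewrite !mxE.
have OPT_le := OPT_cluster_points R d N k s k_gt0 sz_s.
exists d, (map e Y); split.
  (* There are [2 k > k] points; squared distances are at least [D] between clusters and at least
     [d] within one. *)
  apply: (OPT_gt0 _ _ _ _ _ _ (Num.min D d%:R)) => //; first by rewrite sizeY ltn_Pmull.
    by rewrite lt_min D_gt0.
  move=> [v b] [w c] vY wY vw; rewrite ge_min.
  have [vwE|/(sep _ _ vY wY) -> //] := eqVneq v w.
  apply/orP; right; move: vw; rewrite vwE xpair_eqE eqxx /= => bc.
  exact: sqdist_cluster.
move=> T leavesT.
have M2 : 2 <= Num.sqrt k%:R :> R.
  rewrite -[leLHS]ger0_norm // -sqrtr_sqr ler_wsqrtr // -natrX ler_nat.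
  by apply: leq_trans (ltnW k500).
have lnk : ln (size s)%:R <= N%:R :> R by rewrite sz_s.
(* At the root the box is the whole grid; with [M = sqrt k] the entropy [k ln (k / M)] is
   [k ln k / 2]. *)
have intactY v : intact Y v = (v \in s) && in_box d N (fun=> 0%N) (fun=> N) v.
  rewrite /intact !memY andbb; case: (v \in s) => //=.
  by apply/esym/forallP => i; rewrite ltn_ord.
have [] := intact_leaves_bound R d N _ s N_gt0 M2 lnk reg_s T Y _ _ intactY.
have -> : count (in_box d N (fun=> 0%N) (fun=> N)) s = k.
  rewrite -sz_s; apply/eqP; rewrite -all_count; apply/allP => v _.
  by apply/forallP => i; rewrite ltn_ord.
rewrite ln_div_sqrt //.
set l := intact_leaves _ _ _ => _ Hl.
have cost_ge := tree_cost_separated R d _ e D T Y (ltW D_gt0) uniqY sep.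
apply: le_trans cost_ge; rewrite sizeY natrM -/l.
apply: le_trans (excess_bound _ _ _ _ _ _ _ _ kR_gt0 N_gt0 (ltW D_gt0) N_le Hl leavesT) => //.
have coef_ge0 : 0 <= gamma * (ln k%:R ^+ 2 / delta).
  by rewrite mulr_ge0 ?divr_ge0 ?sqr_ge0 ?(ltW delta_gt0) ?(ltW gamma_gt0).
apply: le_trans (ler_wpM2l coef_ge0 OPT_le) _.
exact: ratio (ltW kR_gt0) (ltW d_gt0R) delta_gt0 (ltW L_gt0) N_ge.
Qed.
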